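(* Suppose that a degree $n$ polynomial vector field $\chi$ on $\mathbb{T}^2$ has finitely many invariant meridians taking into account multiplicities. Then $\chi$ can have at most $2(n-1)$ invariant meridians. Moreover, this bound is sharp.
   Context: Fix a real number $a>1$ and let $\mathbb{T}^2=\{(x,y,z)\in\mathbb{R}^3:(x^2+y^2-a^2)^2+z^2-1=0\}$. A triple $\chi=(P,Q,R)$ with $P,Q,R\in\mathbb{R}[x,y,z]$ denotes the polynomial vector field $P\frac{\partial}{\partial x}+Q\frac{\partial}{\partial y}+R\frac{\partial}{\partial z}$ in $\mathbb{R}^3$, acting on polynomials as a derivation; its degree is $\max\{\deg P,\deg Q,\deg R\}$. An algebraic surface $\{g=0\}$ is invariant for $\chi$ if $\chi g=Lg$ for some $L\in\mathbb{R}[x,y,z]$; $\chi$ is a vector field on $\mathbb{T}^2$ if $\{(x^2+y^2-a^2)^2+z^2-1=0\}$ is invariant in this sense. A meridian plane is a plane $\{\lambda x+\mu y=0\}$ with $(\lambda,\mu)\in\mathbb{R}^2\setminus\{(0,0)\}$; it cuts $\mathbb{T}^2$ in two curves, called meridians. A meridian is invariant if its meridian plane is invariant for $\chi$. The multiplicity of an invariant meridian plane $\{\lambda x+\mu y=0\}$ is the largest $k$ such that $(\lambda x+\mu y)^k$ divides the extactic polynomial $\mathcal{E}_{\langle x,y\rangle}(\chi)=\begin{vmatrix}x&y\\ \chi(x)&\chi(y)\end{vmatrix}=xQ-yP$ if this is nonzero, and infinite otherwise. Invariant meridians are counted with multiplicity: an invariant meridian plane of multiplicity $k$ contributes $2k$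 meridians. Sharpness means that the bound $2(n-1)$ is attained by some degree $n$ vector field on $\mathbb{T}^2$ with finitely many invariant meridians. *)

(* Defs.v *)
From mathcomp Require Import all_boot all_order all_algebra.
From mathcomp Require Import all_classical reals.
From mathcomp Require Import mpoly.

Set Implicit Arguments.
Unset Strict Implicit.
Unset Printing Implicit Defensive.

Import Order.TTheory GRing.Theory Num.Theory.
Local Open Scope classical_set_scope.
Local Open Scope ring_scope.

Definition ix : 'I_3 := @Ordinal 3 0 isT.
Definition iy : 'I_3 := @Ordinal 3 1 isT.
Definition iz : 'I_3 := @Ordinal 3 2 isT.

(* The components of [chi : vfield R] are [P = chi ix], [Q = chi iy] and
   [R = chi iz]. *)
Definition vfield (R : realType) := 'I_3 -> {mpoly R[3]}.

Definition vf_apply (R : realType) (chi : vfield R) (f : {mpoly R[3]}) :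
  {mpoly R[3]} := \sum_(i < 3) chi i * f^`M(i).

(* [msize p] is the total degree of [p] plus one, and 0 if [p] is 0; the zero
   vector field gets degree 0. *)
Definition vf_degree (R : realType) (chi : vfield R) : nat :=
  (\max_(i < 3) (msize (chi i)).-1)%N.

Definition invariant_surface (R : realType) (chi : vfield R)
    (g : {mpoly R[3]}) : Prop :=
  exists L : {mpoly R[3]}, vf_apply chi g = L * g.

Definition torus_poly (R : realType) (a : R) : {mpoly R[3]} :=
  ('X_ix ^+ 2 + 'X_iy ^+ 2 - (a ^+ 2)%:MP) ^+ 2 + 'X_iz ^+ 2 - 1.

Definition vfield_on_torus (R : realType) (a : R) (chi : vfield R) : Prop :=
  invariant_surface chi (torus_poly a).

Definition surface (R : realType) (g : {mpoly R[3]}) : set ('I_3 -> R) :=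
  [set v | g.@[v] = 0].

Definition meridian_form (R : realType) (lam mu : R) : {mpoly R[3]} :=
  lam *: 'X_ix + mu *: 'X_iy.

(* Planes are sets of points, so that proportional pairs (lam, mu) give the
   same plane, which is counted only once. *)
Definition meridian_equation (R : realType) (H : set ('I_3 -> R))
    (f : {mpoly R[3]}) : Prop :=
  exists lam mu : R,
    [/\ (lam, mu) != (0, 0), f = meridian_form lam mu & H = surface f].

Definition invariant_meridian_planes (R : realType) (chi : vfield R) :
    set (set ('I_3 -> R)) :=
  [set H | exists f, meridian_equation H f /\ invariant_surface chi f].

Definition extactic (R : realType) (chi : vfield R) (k : nat)
    (v : k.-tuple {mpoly R[3]}) : {mpoly R[3]} :=
  \det (\matrix_(i < k, j < k) iter i (vf_apply chi) (tnth v j)).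

Definition meridian_extactic (R : realType) (chi : vfield R) : {mpoly R[3]} :=
  extactic chi [tuple 'X_ix; 'X_iy].

Definition power_divides (R : realType) (chi : vfield R)
    (H : set ('I_3 -> R)) (k : nat) : Prop :=
  exists f q, meridian_equation H f /\ meridian_extactic chi = q * f ^+ k.

(* [None] stands for infinite multiplicity. *)
Definition meridian_multiplicity (R : realType) (chi : vfield R)
    (H : set ('I_3 -> R)) : option nat :=
  if meridian_extactic chi == 0 then None
  else Some (xget 0%N [set k | power_divides chi H k /\
                        forall j, power_divides chi H j -> (j <= k)%N]).

Definition finitely_many_invariant_meridians (R : realType)
    (chi : vfield R) : Prop :=
  finite_set (invariant_meridian_planes chi) /\
  forall H, invariant_meridian_planes chi H ->
    meridian_multiplicity chi H <> None.

(* A plane of multiplicity k cuts the torus in two meridians and contributes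
   2k. The value is meaningful only under [finitely_many_invariant_meridians]. *)
Definition num_invariant_meridians (R : realType) (chi : vfield R) : nat :=
  \sum_(H \in invariant_meridian_planes chi)
    (2 * odflt 0 (meridian_multiplicity chi H))%N.

(* Main.v *)
(* Let [E = x Q - y P], let [P_m, Q_m, E_m] be homogeneous components and let
   [rho = x ^ 2 + y ^ 2]. The two top homogeneous parts (degrees [n + 3] and
   [n + 2]) of the invariance equation of the torus show that [rho] divides
   [x P_(m-1) + y Q_(m-1)] for every [m >= n]. On the complex line [x = i y] this means
   [Q_(m-1) = - i P_(m-1)], hence [E_m = 0] there. Distinct meridian forms are coprime,
   so [E = q * B] with [B] the product of [N] meridian forms, one for each
   invariant meridian plane counted with multiplicity; [B] does not vanish on [x = i y].
   If [N >= n], then [E_(N+j) = q_j * B] makes every component [q_j] vanish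
   there; [q_0] and [q_1] are real of degree at most 1, so they are zero, and the
   other [q_j] are zero because [E] has degree at most [n + 1]. Hence [E = 0], which
   would make a meridian of infinite multiplicity invariant. So [N <= n - 1].
   The bound is attained by [x ^ (n - 1) * (- y, x, 0)]. *)
From HB Require Import structures.
Require Import Defs.
From mathcomp Require Import all_boot all_order all_algebra.
From mathcomp Require Import all_classical reals.
From mathcomp Require Import mpoly.
From mathcomp Require Import ring lra zify complex.

Set Implicit Arguments.
Unset Strict Implicit.
Unset Printing Implicit Defensive.

Import Order.TTheory GRing.Theory Num.Theory.
Local Open Scope ring_scope.

(** * Homogeneous components of polynomials *)

(* [p(T x_1, ..., T x_n)]: the coefficient of [T ^ j] is the homogeneous component
   of degree [j] of [p]. *)
HB.lock Definition dilate (n : nat) (R : comNzRingType) (p : {mpoly R[n]}) :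
    {poly {mpoly R[n]}} :=
  mmap (polyC \o @mpolyC n R) (fun i => 'X_i *: 'X) p.
Canonical dilate_unlockable := Unlockable dilate.unlock.

Section DilateMorphism.
Variables (n : nat) (R : comNzRingType).

Fact dilate_is_zmod_morphism : zmod_morphism (@dilate n R).
Proof. by move=> p q; rewrite unlock rmorphB. Qed.

Fact dilate_is_monoid_morphism : monoid_morphism (@dilate n R).
Proof. by split=> [|p q]; rewrite unlock ?rmorph1 ?rmorphM. Qed.

HB.instance Definition _ :=
  GRing.isZmodMorphism.Build _ _ (@dilate n R) dilate_is_zmod_morphism.
HB.instance Definition _ :=
  GRing.isMonoidMorphism.Build _ _ (@dilate n R) dilate_is_monoid_morphism.

End DilateMorphism.

Lemma dilateC n (R : comNzRingType) (c : R) : dilate (c%:MP_[n]) = c%:MP%:P.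
Proof. by rewrite unlock mmapC. Qed.

Lemma dilateXU n (R : comNzRingType) (i : 'I_n) :
  @dilate n R 'X_i = ('X_i)%:P * 'X.
Proof. by rewrite unlock mmapX mmap1U mul_polyC. Qed.

Lemma dilateZX n (R : comNzRingType) c (m : 'X_{1..n}) :
  dilate (c *: 'X_[R, m]) = (c *: 'X_[m]) *: 'X^(mdeg m).
Proof.
rewrite unlock mmapZ mmapX /mmap1.
under eq_bigr do rewrite exprZn.
rewrite scaler_prod -mpolyXE_id  prodrXr -mdegE /=.
by rewrite mul_polyC scalerA mul_mpolyC.
Qed.

Lemma coef_dilate n (R : comNzRingType) (p : {mpoly R[n]}) j :
  (dilate p)`_j = \sum_(m <- msupp p | mdeg m == j) p@_m *: 'X_[m].
Proof.
rewrite {1}[p]mpolyE raddf_sum coef_sum [RHS]big_mkcond /=.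
apply: eq_bigr => m _; rewrite dilateZX coefZ coefXn eq_sym.
by case: eqP => _; rewrite ?mulr1 ?mulr0.
Qed.

Lemma size_dilate n (R : comNzRingType) (p : {mpoly R[n]}) :
  (size (dilate p) <= msize p)%N.
Proof.
apply/leq_sizeP => j le_pj; rewrite coef_dilate big_seq_cond big1 // => m.
case/andP=> /msize_mdeg_lt lt_mp /eqP mj.
by move: lt_mp; rewrite mj ltnNge le_pj.
Qed.

(** Setting [T = 1] recovers [p]. *)
Lemma dilate_inj n (R : comNzRingType) : injective (@dilate n R).
Proof.
apply: (can_inj (g := horner_eval 1)) => p.
rewrite {1}[p]mpolyE rmorph_sum /horner_eval horner_sum [RHS]mpolyE.
apply: eq_bigr => m _.
by rewrite /= dilateZX hornerZ hornerXn expr1n mulr1.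
Qed.

Lemma dilate_coef0 n (R : comNzRingType) (p : {mpoly R[n]}) :
  exists c, (dilate p)`_0 = c%:MP.
Proof.
exists (\sum_(m <- msupp p | mdeg m == 0%N) p@_m).
rewrite coef_dilate raddf_sum; apply: eq_bigr => m.
by rewrite mdeg_eq0 => /eqP->; rewrite mpolyX0 alg_mpolyC.
Qed.

Lemma dilate_coef1 n (R : comNzRingType) (p : {mpoly R[n]}) :
  exists c : 'I_n -> R, (dilate p)`_1 = \sum_i c i *: 'X_i.
Proof.
elim/mpolyind: p => [|c m p _ _ [d dE]].
  by exists (fun=> 0); rewrite rmorph0 coef0 big1 // => i _; rewrite scale0r.
rewrite rmorphD coefD dE /= dilateZX coefZ coefXn.
have [mj|_] := boolP (1 == mdeg m)%N; last by exists d; rewrite mulr0 add0r.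
move: mj; rewrite eq_sym => /mdeg1P[j /eqP ->].
exists (fun i => (if i == j then c else 0) + d i).
under [RHS]eq_bigr do rewrite scalerDl.
rewrite big_split /= mulr1; congr (_ + _).
rewrite (bigD1 j) //= eqxx big1 ?addr0 // => i /negPf->.
by rewrite scale0r.
Qed.

Lemma mderivXU n (R : nzRingType) (i j : 'I_n) :
  ('X_j : {mpoly R[n]})^`M(i) = (j == i)%:R.
Proof.
rewrite mderivX mnm1E; case: eqP => [->|_]; last by rewrite scale0r.
by rewrite -{1}[U_(i)%MM]add0m addmK mpolyX0 scale1r.
Qed.

(** * The torus equation and the extactic in coordinates *)

Section MeridianBound.
Variable R : realType.
Implicit Types (chi : vfield R) (p q B : {mpoly R[3]}) (l : R * R).
Implicit Types H : set ('I_3 -> R).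

Lemma vf_applyE chi p :
  vf_apply chi p = chi ix * p^`M(ix) + chi iy * p^`M(iy) + chi iz * p^`M(iz).
Proof.
rewrite /vf_apply !big_ord_recl big_ord0 addr0 addrA.
by congr (chi _ * p^`M(_) + chi _ * p^`M(_) + chi _ * p^`M(_)); apply: val_inj.
Qed.

Lemma vf_apply_torus chi a :
  vf_apply chi (torus_poly a) =
    4 * ('X_ix ^+ 2 + 'X_iy ^+ 2 - (a ^+ 2)%:MP) * ('X_ix * chi ix + 'X_iy * chi iy)
    + 2 * 'X_iz * chi iz.
Proof.
rewrite vf_applyE /torus_poly !expr2.
rewrite !(mderivB, mderivD, mderivM, mderivXU, mderivC, mderivN) /=.
ring.
Qed.

Lemma meridian_extacticE chi :
  meridian_extactic chi = 'X_ix * chi iy - 'X_iy * chi ix.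
Proof.
rewrite /meridian_extactic /extactic (expand_det_row _ ord0) !big_ord_recl big_ord0.
rewrite /cofactor !det_mx11 !mxE /= !(tnth_nth 0) /= !vf_applyE !mderivXU /=.
by rewrite /bump /=; ring.
Qed.

Let rho : {mpoly R[3]} := 'X_ix ^+ 2 + 'X_iy ^+ 2.

Lemma rho_neq0 : rho != 0.
Proof.
apply/eqP => /(congr1 (meval (fun=> 1))); rewrite meval0 mevalD !rmorphXn /= !mevalXU.
by rewrite expr1n; lra.
Qed.

Let radial chi := 'X_ix * chi ix + 'X_iy * chi iy.

(** * Top homogeneous parts of the invariance equation *)

Lemma coef_dilate_XM p (i : 'I_3) j :
  (dilate ('X_i * p))`_j = if j is j'.+1 then 'X_i * (dilate p)`_j' else 0.
Proof.
rewrite rmorphM /= dilateXU -mulrA coefCM coefXM.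
by case: j => [|j] //=; rewrite mulr0.
Qed.

Lemma coef_dilate_vf_degree chi (i : 'I_3) j :
  (vf_degree chi < j)%N -> (dilate (chi i))`_j = 0.
Proof.
move=> lt_nj; apply: nth_default; apply: leq_trans (size_dilate _) _.
apply: leq_trans lt_nj; apply: leq_trans (leqSpred _) _.
by rewrite ltnS; exact: (leq_bigmax i).
Qed.

(** This is the part of degree [j + 2] of the invariance equation. The square of the torus bracket
    has parts of degrees 4, 2 and 0, which meet the components of [L] of degrees [j - 2], [j] and
    [j + 2]. *)
Lemma coef_dilate_torus_eq a chi L (l := dilate L) j :
  vf_apply chi (torus_poly a) = L * torus_poly a ->
  4 * rho * (dilate (radial chi))`_j - 4 * (a ^+ 2)%:MP * (dilate (radial chi))`_j.+2
    + 2 * 'X_iz * (dilate (chi iz))`_j.+1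
  = rho ^+ 2 * (if j is j'.+2 then l`_j' else 0)
    + ('X_iz ^+ 2 - 2 * (a ^+ 2)%:MP * rho) * l`_j
    + ((a ^+ 2)%:MP ^+ 2 - 1) * l`_j.+2.
Proof.
rewrite vf_apply_torus /torus_poly -/rho -/(radial chi).
have [c Dc] : exists c, c = (a ^+ 2)%:MP_[3] by exists (a ^+ 2)%:MP.
have [M DM] : exists M, M = radial chi by exists (radial chi).
have [A DA] : exists A, A = rho - c by exists (rho - c).
have dA : dilate A = rho%:P * 'X^2 - c%:P.
  rewrite DA rmorphB /= {1}Dc dilateC -Dc /rho rmorphD /= !expr2 !rmorphM /=.
  by rewrite !dilateXU; ring.
rewrite -Dc -DA -DM => /(congr1 (@dilate 3 R)).
rewrite !(rmorph_nat, rmorphD, rmorphM, rmorphN, rmorphXn, rmorph1) /=.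
rewrite dA !dilateXU -/l.
move: (dilate M) (dilate (chi iz)) l => {M DM} M r l tE.
pose lhs := (4 * rho)%:P * ('X^2 * M) - (4 * c)%:P * M
  + (2 * 'X_iz)%:P * ('X * r).
pose rhs := (rho ^+ 2)%:P * ('X^4 * l)
   + ('X_iz ^+ 2 - 2 * c * rho)%:P * ('X^2 * l)
   + (c ^+ 2 - 1)%:P * l.
have /(congr1 (fun p : {poly {mpoly R[3]}} => p`_j.+2)) : lhs = rhs.
  rewrite /lhs /rhs; move: rho tE => r2 /eqP.
  rewrite -subr_eq0 => /eqP tE; apply/eqP; rewrite -subr_eq0 -tE; apply/eqP; ring.
rewrite /lhs /rhs !(coefD, coefN, coefCM, coefXnM, coefXM) /= !subn2 /= => ->.
by case: j => [|[|j]] //=; rewrite ?subn4 /= ?subSS ?subn0.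
Qed.

Lemma coef_dilate_radial_dvd a chi j :
  vfield_on_torus a chi -> (vf_degree chi <= j)%N ->
  exists u, (dilate (radial chi))`_j = rho * u.
Proof.
set n := vf_degree chi; move=> [L tE] le_nj.
have tC k := coef_dilate_torus_eq k tE.
have M0 k : (n.+1 < k)%N -> (dilate (radial chi))`_k = 0.
  case: k => // k lt_nk; rewrite rmorphD coefD /= !coef_dilate_XM.
  by rewrite !coef_dilate_vf_degree // !mulr0 addr0.
have r0 k : (n < k)%N -> (dilate (chi iz))`_k = 0.
  exact: coef_dilate_vf_degree.
(* The cofactor has degree below [n]: if its top degree [s] were at least [n], the part of degree
   [s + 4] of the equation would reduce to [rho ^+ 2 * l_s = 0]. *)
have l0 k : (n <= k)%N -> (dilate L)`_k = 0.
  move=> le_nk; have [le_sn|lt_ns] := leqP (size (dilate L)) n.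
    by rewrite nth_default // (leq_trans le_sn).
  have := tC (size (dilate L)).+1; move: lt_ns.
  case sE : (size _) => [|s] // le_ns.
  have s0 i : (s < i)%N -> (dilate L)`_i = 0 by rewrite -sE; apply: nth_default.
  rewrite (M0 s.+2) 1?(M0 s.+4) ?(r0 s.+3) ?(s0 s.+2) ?(s0 s.+4); try lia.
  rewrite !mulr0 subr0 !addr0 => /esym/eqP.
  rewrite mulf_eq0 expf_eq0 (negPf rho_neq0) /= => /eqP ls0.
  have : lead_coef (dilate L) = 0 by rewrite lead_coefE sE.
  by move/eqP; rewrite lead_coef_eq0 -size_poly_eq0 sE.
(* For [j >= n] only [4 * rho * M_j = rho ^+ 2 * v] survives, where [M] is the radial part and [v]
   is the cofactor component of degree [j - 2], or 0 if [j < 2]. *)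
have := tC j; rewrite (M0 j.+2) ?(r0 j.+1) ?(l0 j) ?(l0 j.+2); try lia.
rewrite !mulr0 subr0 !addr0; set v := (X in rho ^+ 2 * X) => uv.
exists ((4^-1)%:MP * v); apply: (@mulfI {mpoly R[3]} _ rho_neq0).
have -> : rho * (rho * ((4^-1)%:MP * v)) = (4^-1)%:MP * (rho ^+ 2 * v) by ring.
have c4 : (4^-1)%:MP * 4 = 1 :> {mpoly R[3]}.
  have -> : 4 = 4%:MP :> {mpoly R[3]} by rewrite rmorph_nat.
  by rewrite -rmorphM mulVf ?pnatr_eq0 ?rmorph1.
by rewrite -uv !mulrA c4 mul1r.
Qed.

(** * Values at isotropic points *)

Lemma coef_dilate_extactic_isotropic (K : comNzRingType)
    (psi : {rmorphism {mpoly R[3]} -> K}) (im : K) a chi j :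
  im ^+ 2 = -1 -> psi 'X_ix = im -> psi 'X_iy = 1 ->
  vfield_on_torus a chi -> (vf_degree chi <= j)%N ->
  psi (dilate (meridian_extactic chi))`_j = 0.
Proof.
move=> im2 psix psiy chi_a le_nj.
have [u /(congr1 psi)] := coef_dilate_radial_dvd chi_a le_nj.
rewrite meridian_extacticE rmorphM /= rmorphD rmorphB !coefD coefN /= !coef_dilate_XM.
have -> : psi rho = 0 by rewrite rmorphD !rmorphXn psix psiy im2 expr1n addNr.
case: j le_nj => [|j] le_nj; first by rewrite subrr rmorph0.
rewrite rmorphB rmorphD !rmorphM /= psix psiy !mul1r mul0r => h.
(* [h] says that [im * P + Q] vanishes; multiplying by [im] turns this into [im * Q - P], the value
   of the extactic component. *)
move/(congr1 ( *%R im)): h; rewrite mulr0 mulrDr mulrA -expr2 im2 => h.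
by rewrite -h mulN1r addrC.
Qed.

(* The real linear factors of the extactic do not vanish at [(i, 1, w)], whereas
   [x ^ 2 + y ^ 2] does. *)
Definition isotropic_point (w : R) (i : 'I_3) : R[i] :=
  tnth [tuple 'i%C; 1; w%:C%C] i.

Definition isotropic_eval (w : R) : {rmorphism {mpoly R[3]} -> R[i]} :=
  GRing.RMorphism.clone _ _ (mmap (real_complex R) (isotropic_point w)) _.

Lemma isotropic_evalC w (c : R) : isotropic_eval w c%:MP = (c%:C)%C.
Proof. exact: mmapC. Qed.

Lemma isotropic_evalZ w (c : R) p :
  isotropic_eval w (c *: p) = (c%:C)%C * isotropic_eval w p.
Proof. exact: mmapZ. Qed.

Lemma isotropic_evalXU w i : isotropic_eval w 'X_i = isotropic_point w i.
Proof. by rewrite /isotropic_eval /= mmapX mmap1U. Qed.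

(** As the [c i] are real, vanishing at [w = 0] and at [w = 1] kills all three of them. *)
Lemma isotropic_eval_linear w (c : 'I_3 -> R) :
  isotropic_eval w (\sum_i c i *: 'X_i) =
  ((c iy + c iz * w) +i* c ix)%C.
Proof.
rewrite !big_ord_recl big_ord0 addr0.
have -> : lift ord0 ord0 = iy by apply: val_inj.
have -> : lift ord0 (lift ord0 ord0) = iz by apply: val_inj.
have -> : ord0 = ix by apply: val_inj.
rewrite !rmorphD !isotropic_evalZ !isotropic_evalXU.
rewrite /isotropic_point !(tnth_nth 0) /=.
apply/eqP; rewrite eq_complex /=; apply/andP; split; apply/eqP; ring.
Qed.

Lemma coef_dilate_extactic_eq0 chi j :
  ((vf_degree chi).+1 < j)%N -> (dilate (meridian_extactic chi))`_j = 0.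
Proof.
case: j => // j lt_nj; rewrite meridian_extacticE rmorphB coefB /= !coef_dilate_XM.
by rewrite !coef_dilate_vf_degree // !mulr0 subrr.
Qed.

(** The equation for [dilate B] encodes that [B] is homogeneous of degree [N], so multiplication by
    [B] matches components of [q] with components of the extactic. *)
Lemma extactic_divisor_degree a chi q B N :
  vfield_on_torus a chi -> meridian_extactic chi != 0 ->
  meridian_extactic chi = q * B -> dilate B = B%:P * 'X^N ->
  (forall w, isotropic_eval w B != 0) -> (N < vf_degree chi)%N.
Proof.
move=> chi_a E0 EqB dB psiB; rewrite ltnNge; apply: contra E0 => le_nN.
have qB j : (dilate q)`_j * B = (dilate (meridian_extactic chi))`_(N + j).
  rewrite EqB rmorphM /= dB mulrA coefMXn ltnNge leq_addr /= addKn.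
  by rewrite coefMC.
have B0 : B != 0.
  by apply: contraNneq (psiB 0) => ->; rewrite rmorph0.
have psiq w j : isotropic_eval w (dilate q)`_j = 0.
  have /eqP := congr1 (isotropic_eval w) (qB j).
  rewrite (@coef_dilate_extactic_isotropic _ _ 'i%C a) //; last first.
  - exact: leq_trans le_nN (leq_addr _ _).
  - by rewrite isotropic_evalXU.
  - by rewrite isotropic_evalXU.
  - by rewrite sqr_i.
  by rewrite rmorphM mulf_eq0 (negPf (psiB w)) orbF => /eqP.
suff q0 : dilate q = 0.
  by rewrite EqB (_ : q = 0) ?mul0r //; apply: dilate_inj; rewrite q0 rmorph0.
apply/polyP => -[|[|j]]; rewrite coef0.
- have [c cE] := dilate_coef0 q; have := psiq 0 0%N.
  by rewrite cE isotropic_evalC => -[->]; rewrite rmorph0.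
- have [c cE] := dilate_coef1 q; rewrite cE.
  have := psiq 0 1%N; have := psiq 1 1%N.
  rewrite cE !isotropic_eval_linear mulr1 mulr0 addr0 => -[h _] [c1 c0].
  have c2 : c iz = 0 by rewrite c1 add0r in h.
  apply: big1 => i _; have /or3P[] : [|| i == ix, i == iy | i == iz].
  + by case: i => -[|[|[|]]].
  + by move/eqP->; rewrite c0 scale0r.
  + by move/eqP->; rewrite c1 scale0r.
  + by move/eqP->; rewrite c2 scale0r.
(* Here the extactic component has degree [N + j + 2], which exceeds [n + 1] as [N >= n]. *)
- apply: (mulIf B0); rewrite qB mul0r coef_dilate_extactic_eq0 //.
  by lia.
Qed.

(** * Divisibility by meridian forms *)

Definition plane_form l := meridian_form l.1 l.2.

Lemma meval_form l v : (plane_form l).@[v] = l.1 * v ix + l.2 * v iy.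
Proof. by rewrite mevalD !mevalZ !mevalXU. Qed.

Lemma dilate_form l : dilate (plane_form l) = (plane_form l)%:P * 'X.
Proof.
rewrite /plane_form /meridian_form -!mul_mpolyC.
by rewrite rmorphD !rmorphM /= !dilateC !dilateXU; ring.
Qed.

Lemma isotropic_eval_form l w : l != (0, 0) -> isotropic_eval w (plane_form l) != 0.
Proof.
case: l => [lam mu] l0; rewrite /plane_form /meridian_form.
rewrite rmorphD !isotropic_evalZ !isotropic_evalXU /isotropic_point !(tnth_nth 0) /=.
apply: contraNneq l0 => /eqP; rewrite eq_complex /= => /andP[/eqP h1 /eqP h2].
by apply/eqP; congr pair; lra.
Qed.

(* The plane [l.1 x + l.2 y = 0] consists of the points [(l.2 t, - l.1 t, z)];
   [direction l] is [t] as a linear form in [x] and [y]. *)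
Definition direction l : {mpoly R[3]} :=
  (l.1 ^+ 2 + l.2 ^+ 2)^-1 *: (l.2 *: 'X_ix - l.1 *: 'X_iy).

(** For nonzero [l] this is composition with the orthogonal projection onto the plane of [l], so it
    plays the role of restriction to that plane. *)
Definition form_subst l : {rmorphism {mpoly R[3]} -> {mpoly R[3]}} :=
  GRing.RMorphism.clone _ _
    (mmap (@mpolyC 3 R)
       (tnth [tuple l.2 *: direction l; - l.1 *: direction l; 'X_iz])) _.

Lemma form_substC l c : form_subst l c%:MP = c%:MP.
Proof. exact: mmapC. Qed.

Lemma form_substZ l c p : form_subst l (c *: p) = c *: form_subst l p.
Proof. by rewrite -[RHS]mul_mpolyC; exact: mmapZ. Qed.

Lemma form_substXU l i : form_subst l 'X_i =
  tnth [tuple l.2 *: direction l; - l.1 *: direction l; 'X_iz] i.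
Proof. by rewrite /form_subst /= mmapX mmap1U. Qed.

Lemma sqr_sum_neq0 l : l != (0, 0) -> l.1 ^+ 2 + l.2 ^+ 2 != 0.
Proof.
case: l => [lam mu]; apply: contraNneq => /eqP /=.
by rewrite paddr_eq0 ?sqr_ge0 // !sqrf_eq0 => /andP[/eqP-> /eqP->].
Qed.

(** The scalar is the determinant of [l'] and [l]: for nonzero [l], the form of [l'] restricts to 0
    only if the pairs are proportional. *)
Lemma form_subst_form l l' :
  form_subst l (plane_form l') = (l'.1 * l.2 - l'.2 * l.1) *: direction l.
Proof.
rewrite /plane_form /meridian_form rmorphD !form_substZ !form_substXU !(tnth_nth 0) /=.
by move: (direction l) => t; rewrite !scalerA -scalerDl mulrN.
Qed.

Lemma form_subst_self l : form_subst l (plane_form l) = 0.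
Proof. by rewrite form_subst_form mulrC subrr scale0r. Qed.

Lemma direction_neq0 l : l != (0, 0) -> direction l != 0.
Proof.
move=> l0; apply/eqP => /(congr1 (meval (tnth [tuple l.2; - l.1; 0]))).
rewrite meval0 /direction mevalZ mevalB !mevalZ !mevalXU !(tnth_nth 0) /=.
move/eqP; rewrite mulf_eq0 invr_eq0 (negPf (sqr_sum_neq0 l0)) /=.
by rewrite mulrN opprK -!expr2 addrC (negPf (sqr_sum_neq0 l0)).
Qed.

(** A ring morphism congruent to the identity on constants and variables is congruent to it on all
    polynomials. *)
Lemma form_subst_eqmod l p : l != (0, 0) ->
  exists q, p - form_subst l p = q * plane_form l.
Proof.
move=> l0; have s0 := sqr_sum_neq0 l0.
pose P p := exists q, p - form_subst l p = q * plane_form l.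
have PC c : P c%:MP by exists 0; rewrite form_substC subrr mul0r.
have PD p1 p2 : P p1 -> P p2 -> P (p1 + p2).
  move=> [q1 E1] [q2 E2]; exists (q1 + q2).
  by rewrite mulrDl -E1 -E2 rmorphD /= opprD addrACA.
have PM p1 p2 : P p1 -> P p2 -> P (p1 * p2).
  move=> [q1 E1] [q2 E2]; exists (q1 * p2 + form_subst l p1 * q2).
  rewrite mulrDl mulrAC -E1 -mulrA -E2 rmorphM /=.
  by rewrite mulrBl mulrBr addrA subrK.
have PX i : P 'X_i.
  rewrite /P form_substXU (tnth_nth 0) /direction /plane_form /meridian_form.
  set s := _ + _ in s0 *.
  have sE : s^-1 * (l.1 ^+ 2 + l.2 ^+ 2) = 1 by rewrite mulVf.
  have /(congr1 (@mpolyC 3 R)) := sE; rewrite rmorphM rmorphD !rmorphXn rmorph1 /=.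
  rewrite -!mul_mpolyC => {}sE.
  (* With [t] the direction form and [s] the sum of squares, [x - l.2 t] and [y + l.1 t] are the
     plane form times [l.1 / s] and [l.2 / s]. *)
  case: i => -[|[|[|//]]] lt /=.
  - exists (s^-1%:MP * l.1%:MP).
    rewrite (_ : Ordinal lt = ix); last exact: val_inj.
    by rewrite -[X in X - _]mul1r -sE; ring.
  - exists (s^-1%:MP * l.2%:MP).
    rewrite (_ : Ordinal lt = iy); last exact: val_inj.
    by rewrite -[X in X - _]mul1r -sE rmorphN /=; ring.
  - exists 0; rewrite (_ : Ordinal lt = iz); last exact: val_inj.
    by rewrite subrr mul0r.
elim/mpolyind: p => [|c m p _ _ Pp]; first by rewrite -(rmorph0 (@mpolyC 3 R)); exact: PC.
apply: (PD) Pp; rewrite -mul_mpolyC; apply: (PM) => //.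
rewrite mpolyXE_id; elim/big_rec: _ => [|i q _ Pq].
  by rewrite -(rmorph1 (@mpolyC 3 R)); exact: PC.
apply: (PM) Pq; elim: (m i) => [|k IH]; last by rewrite exprS; apply: PM.
by rewrite expr0 -(rmorph1 (@mpolyC 3 R)); exact: PC.
Qed.

Lemma form_neq0 l : l != (0, 0) -> plane_form l != 0.
Proof.
by move=> /(isotropic_eval_form 0); apply: contraNneq => ->; rewrite rmorph0.
Qed.

Lemma form_subst_eq0 l p : l != (0, 0) -> form_subst l p = 0 ->
  exists q, p = q * plane_form l.
Proof. by move=> /(form_subst_eqmod p)[q E] p0; exists q; rewrite -E p0 subr0. Qed.

(** The plane form is prime, since restriction to its plane has values in an integral domain and
    kernel generated by the form. Its factors are moved from the product into [p] one at a time. *)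
Lemma form_expn_gauss l p B q k : l != (0, 0) -> form_subst l B != 0 ->
  p * B = q * plane_form l ^+ k -> exists q', p = q' * plane_form l ^+ k.
Proof.
move=> l0 B0; elim: k p q => [|k IH] p q; first by exists p; rewrite expr0 mulr1.
rewrite exprSr mulrA => pB.
have /eqP : form_subst l (p * B) = 0 by rewrite pB rmorphM /= form_subst_self mulr0.
rewrite rmorphM mulf_eq0 (negPf B0) orbF => /eqP/(form_subst_eq0 l0)[p1 p1E].
have /IH[q' q'E] : p1 * B = q * plane_form l ^+ k.
  by apply: (mulIf (form_neq0 l0)); rewrite -pB p1E mulrAC.
by exists q'; rewrite mulrA -q'E.
Qed.

Lemma surface_form_subset l l' : l != (0, 0) -> l'.1 * l.2 - l'.2 * l.1 = 0 ->
  (surface (plane_form l) `<=` surface (plane_form l'))%classic.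
Proof.
move=> l0 ll' v; rewrite /surface /= !meval_form => lv.
apply/eqP; apply: contraNT l0 => l'v; case: l ll' lv => lam mu /= ll' lv.
(* Cramer's rule: [lam] and [mu] times the value of the second form at [v] are combinations of the
   first form at [v] and the determinant. A nonzero value would force [lam = mu = 0]. *)
have h1 : lam * (l'.1 * v ix + l'.2 * v iy) = 0.
  have -> : lam * (l'.1 * v ix + l'.2 * v iy) =
      l'.1 * (lam * v ix + mu * v iy) - (l'.1 * mu - l'.2 * lam) * v iy by ring.
  by rewrite lv ll' mul0r mulr0 subrr.
have h2 : mu * (l'.1 * v ix + l'.2 * v iy) = 0.
  have -> : mu * (l'.1 * v ix + l'.2 * v iy) =
      l'.2 * (lam * v ix + mu * v iy) + (l'.1 * mu - l'.2 * lam) * v ix by ring.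
  by rewrite lv ll' mul0r mulr0 addr0.
move/eqP: h1; move/eqP: h2; rewrite !mulf_eq0 (negPf l'v) !orbF => /eqP-> /eqP->.
exact: eqxx.
Qed.

Lemma surface_form_eq l l' : l != (0, 0) -> l' != (0, 0) ->
  l'.1 * l.2 - l'.2 * l.1 = 0 -> surface (plane_form l) = surface (plane_form l').
Proof.
move=> l0 l'0 ll'; apply/seteqP; split; apply: surface_form_subset => //.
by rewrite -[LHS]opprK opprB [l.2 * _]mulrC [l.1 * _]mulrC ll' oppr0.
Qed.

(** * Multiplicities and the product of the invariant forms *)

Definition finite_multiplicity chi H := odflt 0%N (meridian_multiplicity chi H).

Lemma power_divides_multiplicity chi H : meridian_extactic chi != 0 ->
  invariant_meridian_planes chi H -> power_divides chi H (finite_multiplicity chi H).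
Proof.
move=> E0 [f [Hf _]]; rewrite /finite_multiplicity /meridian_multiplicity (negPf E0) /=.
(* The default value 0 of [xget] also satisfies the claim, because [f ^+ 0 = 1]. *)
case: xgetP => [_ _ []//|_]; exists f, (meridian_extactic chi).
by rewrite expr0 mulr1.
Qed.

Lemma multiplicity_form chi H : meridian_extactic chi != 0 ->
  invariant_meridian_planes chi H ->
  exists l, [/\ l != (0, 0), H = surface (plane_form l) &
    exists q, meridian_extactic chi = q * plane_form l ^+ finite_multiplicity chi H].
Proof.
move=> E0 /(power_divides_multiplicity E0)[_ [q [[lam [mu [l0 -> HE]]] EE]]].
by exists (lam, mu); split=> //; exists q.
Qed.

(** By induction on [s]: distinct planes have non-proportional forms, so the product over the tail
    does not vanish on the plane of the head, and the head's power divides the remaining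
    quotient. *)
Lemma prod_forms_dvd p (s : seq (set ('I_3 -> R))) (k : set ('I_3 -> R) -> nat)
    (lin : set ('I_3 -> R) -> R * R) :
  uniq s ->
  (forall H, H \in s -> [/\ lin H != (0, 0), H = surface (plane_form (lin H)) &
     exists q, p = q * plane_form (lin H) ^+ k H]) ->
  exists q, p = q * \prod_(H <- s) plane_form (lin H) ^+ k H.
Proof.
elim: s => [|H s IH] /=; first by exists p; rewrite big_nil mulr1.
move=> /andP[Hs us] lin_s.
have [|q qE] := IH us; first by move=> G Gs; apply: lin_s; rewrite inE Gs orbT.
have [l0 HE [r rE]] := lin_s H (mem_head _ _).
have [] := @form_expn_gauss (lin H) q
  (\prod_(G <- s) plane_form (lin G) ^+ k G) r (k H) l0.
- rewrite rmorph_prod prodf_seq_neq0; apply/allP => G Gs /=.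
  have [m0 GE _] := lin_s G (mem_behead (s := H :: s) Gs).
  rewrite rmorphXn expf_neq0 //= form_subst_form scaler_eq0 negb_or.
  rewrite direction_neq0 // andbT.
  apply: contraNneq Hs => lG; rewrite HE (surface_form_eq l0 m0) //.
  by rewrite -GE.
- by rewrite -qE -rE.
by move=> q' q'E; exists q'; rewrite big_cons mulrA -q'E.
Qed.

Lemma dilate_prod_forms (s : seq (set ('I_3 -> R))) (k : set ('I_3 -> R) -> nat)
    (lin : set ('I_3 -> R) -> R * R) (B := \prod_(H <- s) plane_form (lin H) ^+ k H) :
  dilate B = B%:P * 'X^(\sum_(H <- s) k H).
Proof.
rewrite /B !rmorph_prod /= -prodrXr -big_split /=; apply: eq_bigr => H _.
by rewrite !rmorphXn /= dilate_form exprMn.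
Qed.

(** If [x Q = y P], then [x] divides [P], so the plane [x = 0] is invariant and has infinite
    multiplicity. *)
Lemma meridian_extactic_neq0 chi :
  finitely_many_invariant_meridians chi -> meridian_extactic chi != 0.
Proof.
move=> [_ multN]; apply/negP => /eqP E0.
have l0 : (1, 0) != (0, 0) :> R * R by rewrite xpair_eqE oner_eq0.
have fx : plane_form (1, 0) = 'X_ix :> {mpoly R[3]}.
  by rewrite /plane_form /meridian_form scale1r scale0r addr0.
have [q chiq] : exists q, chi ix = q * plane_form (1, 0).
  apply: form_subst_eq0 => //; apply/eqP.
  move: E0; rewrite meridian_extacticE => /(congr1 (form_subst (1, 0))).
  rewrite rmorphB !rmorphM /= -[X in X * _ - _]/(form_subst (1, 0) 'X_ix) -fx.
  rewrite form_subst_self mul0r sub0r rmorph0 => /eqP; rewrite oppr_eq0 mulf_eq0.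
  have -> : form_subst (1, 0) 'X_iy = - direction (1, 0) :> {mpoly R[3]}.
    by rewrite form_substXU (tnth_nth 0) /= scaleN1r.
  by rewrite oppr_eq0 (negPf (direction_neq0 l0)).
apply: (multN (surface (plane_form (1, 0)))); last first.
  by rewrite /meridian_multiplicity E0 eqxx.
exists (plane_form (1, 0)); split; first by exists 1, 0.
by exists q; rewrite -chiq fx vf_applyE !mderivXU /=; ring.
Qed.

(** Adding 2 on the left avoids truncated subtraction; the inequality also forces a positive
    degree. *)
Lemma num_invariant_meridians_le a chi :
  vfield_on_torus a chi -> finitely_many_invariant_meridians chi ->
  ((num_invariant_meridians chi).+2 <= 2 * vf_degree chi)%N.
Proof.
move=> chi_a fin; have E0 := meridian_extactic_neq0 fin.
case: fin => planes_fin _; rewrite /num_invariant_meridians fsbig_finite //=.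
set s := finmap.enum_fset _; set num := (X in X.+2).
have -> : num = (2 * \sum_(H <- s) finite_multiplicity chi H)%N by rewrite big_distrr.
rewrite -add2n -mulnS leq_mul2l /= {num}.
(* One pair of coefficients is chosen for each plane, with the power of its form dividing the
   extactic as part of the choice. *)
pose L H := [set l | [/\ l != (0, 0), H = surface (plane_form l) &
  exists q, meridian_extactic chi =
    q * plane_form l ^+ finite_multiplicity chi H]]%classic.
pose lin H := xget (0, 0) (L H).
have linP H : H \in s -> L H (lin H).
  rewrite in_fset_set // inE => /(multiplicity_form E0)[l lP].
  exact: xgetPex (ex_intro _ l lP).
have [|q EE] :=
  @prod_forms_dvd (meridian_extactic chi) s (finite_multiplicity chi) lin _ linP.
  exact: finmap.fset_uniq.
apply: extactic_divisor_degree chi_a E0 EE (dilate_prod_forms _ _ _) _ => w.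
rewrite rmorph_prod prodf_seq_neq0; apply/allP => H /linP[l0 _ _] /=.
by rewrite rmorphXn expf_neq0 // isotropic_eval_form.
Qed.

(** * Sharpness: rotation about the [z]-axis, rescaled *)

Definition rotation_field (m : nat) : vfield R := fun i =>
  tnth [tuple - ('X_ix ^+ m * 'X_iy); 'X_ix ^+ m * 'X_ix; 0] i.

Lemma rotation_fieldE m :
  ((rotation_field m ix = (- ('X_ix ^+ m * 'X_iy))%R) *
   (rotation_field m iy = ('X_ix ^+ m * 'X_ix)%R) * (rotation_field m iz = 0))%type.
Proof. by rewrite /rotation_field !(tnth_nth 0). Qed.

(** Rotations preserve [x ^ 2 + y ^ 2] and [z], so the cofactor is 0. *)
Lemma rotation_field_on_torus m a : vfield_on_torus a (rotation_field m).
Proof.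
by exists 0; rewrite vf_apply_torus !rotation_fieldE; ring.
Qed.

Lemma rotation_field_degree m : vf_degree (rotation_field m) = m.+1.
Proof.
rewrite /vf_degree !big_ord_recl big_ord0 /rotation_field !(tnth_nth 0) /=.
rewrite msizeN mmeasure0 !mpolyXn -!mpolyXD !msizeX !mdegD !mdegMn !mdeg1.
by rewrite mul1n addn1 maxn0 maxnn.
Qed.

Lemma rotation_field_extactic m : meridian_extactic (rotation_field m) =
  'X_ix ^+ m * ('X_ix ^+ 2 + 'X_iy ^+ 2).
Proof. by rewrite meridian_extacticE !rotation_fieldE; ring. Qed.

Lemma vf_apply_form chi l : vf_apply chi (plane_form l) = l.1 *: chi ix + l.2 *: chi iy.
Proof.
rewrite vf_applyE /plane_form /meridian_form !mderivD !mderivZ !mderivXU /=.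
by rewrite -!mul_mpolyC; ring.
Qed.

Lemma rotation_field_plane m H :
  invariant_meridian_planes (rotation_field m) H ->
  (0 < m)%N /\ H = surface (plane_form (1, 0)).
Proof.
move=> [_ [[lam [mu [l0 -> HE]]] [L]]]; rewrite -/(plane_form (lam, mu)) vf_apply_form /=.
(* At the point [(mu, - lam, 0)] of the plane the derivative of the form is
   [mu ^+ m * (lam ^+ 2 + mu ^+ 2)]; its vanishing requires both [mu = 0] and [0 < m]. *)
move=> /(congr1 (meval (tnth [tuple mu; - lam; 0]))).
rewrite mevalM meval_form !rotation_fieldE mevalD !mevalZ mevalN !mevalM.
rewrite !rmorphXn /= !mevalXU !(tnth_nth 0) /=.
have -> : lam * mu + mu * - lam = 0 by ring.
have -> : lam * - (mu ^+ m * - lam) + mu * (mu ^+ m * mu) =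
    mu ^+ m * (lam ^+ 2 + mu ^+ 2) by ring.
rewrite mulr0 => /eqP; rewrite mulf_eq0 (negPf (sqr_sum_neq0 l0)) orbF expf_eq0.
case/andP=> m0 /eqP mu0; split => //; rewrite HE -/(plane_form (lam, mu)) mu0.
apply: surface_form_eq; rewrite ?xpair_eqE ?oner_eq0 //=; last by rewrite mulr0 mul0r subrr.
by move: l0; rewrite mu0 xpair_eqE eqxx.
Qed.

Lemma rotation_field_planes m : (0 < m)%N ->
  invariant_meridian_planes (rotation_field m) =
    [set surface (plane_form (1, 0))]%classic.
Proof.
move=> m0; apply/seteqP; split=> [H /rotation_field_plane[]//|_ ->].
exists (plane_form (1, 0)); split.
  by exists 1, 0; split=> //; rewrite xpair_eqE oner_eq0.
exists (- ('X_ix ^+ m.-1 * 'X_iy)).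
rewrite vf_apply_form !rotation_fieldE /= -{1}(prednK m0) exprS.
rewrite /plane_form /meridian_form /=.
by rewrite !scale1r !scale0r; ring.
Qed.

Lemma rotation_field_planes0 : invariant_meridian_planes (rotation_field 0) = set0.
Proof. by apply/seteqP; split=> // H /rotation_field_plane[]. Qed.

Lemma rotation_field_multiplicity m :
  meridian_multiplicity (rotation_field m) (surface (plane_form (1, 0))) = Some m.
Proof.
rewrite /meridian_multiplicity rotation_field_extactic.
set E := 'X_ix ^+ m * _; case: eqP => [E0|_].
  have := congr1 (meval (fun=> 1)) E0.
  rewrite meval0 mevalM mevalD !rmorphXn /= !mevalXU !expr1n mul1r => h.
  by have := @pnatr_eq0 R 2; rewrite [2]h eqxx.
congr Some.
have dvd_m : power_divides (rotation_field m) (surface (plane_form (1, 0))) m.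
  exists (plane_form (1, 0)), ('X_ix ^+ 2 + 'X_iy ^+ 2); split.
    by exists 1, 0; split=> //; rewrite xpair_eqE oner_eq0.
  rewrite rotation_field_extactic mulrC /plane_form /meridian_form /=.
  by rewrite scale1r scale0r addr0.
have le_m k :
    power_divides (rotation_field m) (surface (plane_form (1, 0))) k -> (k <= m)%N.
  move=> [_ [q [[lam [mu [l0 -> HE]]]]]]; rewrite rotation_field_extactic leqNgt => EE.
  apply/negP => lt_mk.
  (* The point [(0, 1, 0)] of the plane shows that every equation of it is a multiple of [x]. *)
  have mu0 : mu = 0.
    have : surface (plane_form (1, 0)) (tnth [tuple 0; 1; 0] : _ -> R).
      by rewrite /surface /= meval_form !(tnth_nth 0) /= mulr0 mul0r addr0.
    rewrite HE -/(plane_form (lam, mu)) /surface /= meval_form !(tnth_nth 0) /=.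
    by rewrite mulr0 add0r mulr1.
  (* After cancelling [x ^ m], a further factor [x] would divide [x ^ 2 + y ^ 2], which equals 1 at
     [(0, 1, 0)]. *)
  move: EE; rewrite -(subnKC lt_mk) addSnnS exprD mu0 /meridian_form scale0r addr0.
  rewrite exprZn -scalerAl scalerAr mulrCA => /(mulfI _) EE.
  have /EE/(congr1 (meval (tnth [tuple 0; 1; 0]))) : ('X_ix ^+ m : {mpoly R[3]}) != 0.
    by rewrite mpolyXn -msize_poly_eq0 msizeX.
  rewrite mevalD !mevalM mevalZ !rmorphXn /= mevalZ !mevalXU !(tnth_nth 0) /=.
  by rewrite !mulr0 exprS mul0r !mulr0 add0r mulr1 => /eqP; rewrite oner_eq0.
case: xgetP => [k _ [/le_m le_km /(_ m dvd_m) le_mk]|/(_ m) []//].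
by apply/eqP; rewrite eqn_leq le_km.
Qed.

End MeridianBound.

Theorem theorem5p1 (R : realType) (a : R) (ha : 1 < a) :
  (forall (n : nat) (chi : vfield R),
     vfield_on_torus a chi ->
     vf_degree chi = n ->
     finitely_many_invariant_meridians chi ->
     (num_invariant_meridians chi)%:Z <= 2 * (n%:Z - 1)) /\
  (forall n : nat, (1 <= n)%N ->
     exists chi : vfield R,
       [/\ vfield_on_torus a chi,
           vf_degree chi = n,
           finitely_many_invariant_meridians chi
         & (num_invariant_meridians chi)%:Z = 2 * (n%:Z - 1)]).
Proof.
split=> [n chi chi_a <- fin|[//|m] _].
  have := num_invariant_meridians_le chi_a fin; lia.
exists (rotation_field R m); split.
- exact: rotation_field_on_torus.
- exact: rotation_field_degree.
(* For [m = 0], that is degree 1, there is no invariant meridian plane and the bound is 0. *)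
- case: m => [|m]; first by split; rewrite rotation_field_planes0.
  rewrite /finitely_many_invariant_meridians rotation_field_planes //; split.
    exact: finite_set1.
  by move=> _ ->; rewrite rotation_field_multiplicity.
- rewrite /num_invariant_meridians; case: m => [|m].
    by rewrite rotation_field_planes0 fsbig_set0.
  rewrite rotation_field_planes // fsbig_set1.
  by rewrite rotation_field_multiplicity /=; lia.
Qed.
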